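(* Let $n\geq 2$ and $d\geq 1$ be integers with $\gcd(n,d)=1$, let $r$ be an integer, and let $f_0(q),f_1(q),\ldots,f_{n-1}(q)\in\mathbb Z[q]$. For $0\le k\le n-1$ put $$\tilde{f}_k(q)=\sum_{j=0}^k(-1)^jq^{\binom{j}{2}-kj}\begin{bmatrix}k\\ j\end{bmatrix}_q f_j(q).$$ Let $a\in\{0,1,\ldots,n-1\}$ be the unique integer with $ad\equiv -r\pmod n$ (i.e. $a=\langle -r/d\rangle_n$). Then, if $n$ is odd, \begin{align*} &\sum_{k=0}^{n-1} \frac{(q^r;q^d)_k(q^{d-r};q^d)_k}{(q^d;q^d)_k^2}\, f_k(q^d)\\ \equiv\;& (-1)^aq^{d\binom{a+1}2+\frac{(ad+r)(n-1-2a)}{2}}\sum_{k=0}^{n-1}\frac{(q^r;q^d)_k(q^{d-r};q^d)_k}{(q^d;q^d)_k^2}\, \tilde{f}_k(q^d)\pmod{\Phi_n(q)^2}, \end{align*} and, if $n$ is even, \begin{align*} &\sum_{k=0}^{n-1} \frac{(q^r;q^d)_k(q^{d-r};q^d)_k}{(q^d;q^d)_k^2}\, f_k(q^d)\\ \equiv\;& (-1)^{a+\frac{ad+r}{n}}q^{d\binom{a+1}2+\frac{(ad+r)(n-1-2a)}{2}}\sum_{k=0}^{n-1}\frac{(q^r;q^d)_k(q^{d-r};q^d)_k}{(q^d;q^d)_k^2}\, \tilde{f}_k(q^d)\pmod{\Phi_n(q)^2}. \end{align*} Here $\tilde f_k(q^d)$ and $f_k(q^d)$ denote $\tilde f_k$,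 $f_k$ evaluated at $q^d$.
   Context: For $x$ and an integer $n\ge 0$, $(x;q)_n=(1-x)(1-xq)\cdots(1-xq^{n-1})$ for $n\ge1$ and $(x;q)_0=1$. For integers $0\le j\le k$, $\begin{bmatrix}k\\ j\end{bmatrix}_q=\frac{(q;q)_k}{(q;q)_j(q;q)_{k-j}}$ is the Gaussian binomial coefficient. $\Phi_n(q)$ is the $n$-th cyclotomic polynomial. The expressions involved are rational functions in $q$ (Laurent polynomials divided by products of factors $1-q^{dj}$ with $1\le j\le n-1$), whose denominators are coprime to $\Phi_n(q)$; a congruence $A\equiv B\pmod{\Phi_n(q)^2}$ between such rational functions means that $A-B=\Phi_n(q)^2\,P(q)/Q(q)$ with $P,Q\in\mathbb Z[q]$ and $Q$ coprime to $\Phi_n(q)$. Note that $ad+r$ is divisible by $n$, so $\frac{ad+r}{n}$ is an integer, and the exponent $\frac{(ad+r)(n-1-2a)}{2}$ is an integer. *)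

(* Defs.v *)
From HB Require Import structures.
From mathcomp Require Import all_boot all_order all_algebra fraction cyclotomic.
Set Implicit Arguments. Unset Strict Implicit. Unset Printing Implicit Defensive.
Import Order.TTheory GRing.Theory Num.Theory.
Local Open Scope ring_scope.

Definition RF := {fraction {poly int}}.
Definition toRF (p : {poly int}) : RF := tofrac p.
Definition qq : RF := toRF 'X.

Definition qpoch (x y : RF) (k : nat) : RF := \prod_(i < k) (1 - x * y ^+ i).

Definition qbinom (y : RF) (k j : nat) : RF :=
  qpoch y y k / (qpoch y y j * qpoch y y (k - j)).

Definition evalRF (p : {poly int}) (x : RF) : RF := (map_poly (intr : int -> RF) p).[x].

Definition ftilde (f : nat -> {poly int}) (k : nat) (x : RF) : RF :=
  \sum_(j < k.+1)
     (-1) ^+ j * x ^ ((('C(j, 2))%:Z - (k * j)%:Z)%R) * qbinom x k j * evalRF (f j) x.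

Definition coefk (d : nat) (r : int) (k : nat) : RF :=
  qpoch (qq ^ r) (qq ^+ d) k * qpoch (qq ^ (d%:Z - r)) (qq ^+ d) k
  / (qpoch (qq ^+ d) (qq ^+ d) k) ^+ 2.

Definition congPhi2 (n : nat) (A B : RF) : Prop :=
  exists P Q : {poly int},
    coprimep (map_poly (intr : int -> rat) Q) (map_poly (intr : int -> rat) 'Phi_n)
    /\ A - B = (toRF 'Phi_n) ^+ 2 * toRF P / toRF Q.

(* Main.v *)
Require Import Defs.
From HB Require Import structures.
From mathcomp Require Import all_boot all_order all_algebra fraction cyclotomic.
From mathcomp Require Import algC.
From mathcomp Require Import ring zify.
Import Order.TTheory GRing.Theory Num.Theory.
Local Open Scope ring_scope.

(** With [y = q^d] and [N = (ad + r)/n], write [q^r = y^-a (q^n)^N] and compare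
the two sides coefficient by coefficient in the [f_j].  Each of the [n]
differences, and the prefactor as well, is built from powers [v^N] with [v]
congruent to 1 modulo [Phi_n] ([v = q^n], or [v = -q^(n/2)] for even [n]), so modulo
[Phi_n^2] it is an affine function of [N].  It is exactly 0 for [N = 0] and
[N = d]: there [q^r] is [y^-a], resp. [q^(d-r)] is [y^-(n-1-a)], the sums terminate,
and the q-Vandermonde identity evaluates them.  Since [d] is invertible modulo
[Phi_n^2], the affine function is zero for every [N]. *)

(** * q-shifted factorials, q-Vandermonde, and the terminating case *)

Section QSeries.

Variable K : fieldType.

Definition poch (x y : K) (k : nat) : K := \prod_(i < k) (1 - x * y ^+ i).

Definition gauss (y : K) (k j : nat) : K :=
  poch y y k / (poch y y j * poch y y (k - j)).

Lemma pochD (x y : K) m l : poch x y (m + l) = poch x y m * poch (x * y ^+ m) y l.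
Proof.
rewrite /poch big_split_ord /=; congr (_ * _).
by apply: eq_bigr => i _; rewrite exprD mulrA.
Qed.

Lemma poch0 (x y : K) : poch x y 0 = 1. Proof. by rewrite /poch big_ord0. Qed.

Lemma pochSr (x y : K) k : poch x y k.+1 = poch x y k * (1 - x * y ^+ k).
Proof. by rewrite /poch big_ord_recr. Qed.

Lemma pochSl (x y : K) k : poch x y k.+1 = (1 - x) * poch (x * y) y k.
Proof. by rewrite -add1n pochD pochSr poch0 expr1 expr0 mul1r mulr1. Qed.

(* Unlike the quotient [gauss], this is 0 for [l > b], and [gbinom_poch] makes
   it agree with [gauss] for [l <= b]. *)
Fixpoint gbinom (y : K) (b l : nat) : K :=
  match b, l with
  | _, 0 => 1
  | 0, _.+1 => 0
  | b'.+1, l'.+1 => y ^+ l * gbinom y b' l + gbinom y b' l'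
  end.

Lemma gbinom0 (y : K) b : gbinom y b 0 = 1. Proof. by case: b. Qed.

Lemma gbinomS (y : K) b l :
  gbinom y b.+1 l.+1 = y ^+ l.+1 * gbinom y b l.+1 + gbinom y b l.
Proof. by []. Qed.

Lemma gbinom_small (y : K) b l : (b < l)%N -> gbinom y b l = 0.
Proof.
by elim: b l => [|b IH] [|l] // lbl; rewrite gbinomS !IH ?mulr0 ?addr0 //; lia.
Qed.

(** The q-Chu-Vandermonde sum 2phi1(y^-b, B; BD; y, D y^b) = (D;y)_b / (BD;y)_b, cleared of
    denominators so that no nonvanishing condition arises. [D] varies in the induction because the
    Pascal rule leads from [b.+1] with [D] to [b] with [D * y]. *)
Lemma q_vandermonde y B D b :
  \sum_(l < b.+1) (-1) ^+ l * y ^+ 'C(l, 2) * gbinom y b l * poch B y l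
     * poch (B * D * y ^+ l) y (b - l) * D ^+ l = poch D y b.
Proof.
elim: b D => [|b IH] D.
  by rewrite big_ord_recl big_ord0 /= !poch0 !expr0; ring.
rewrite pochSl -IH big_ord_recl.
under eq_bigr => l _ do rewrite lift0 gbinomS mulrDr !mulrDl subSS.
rewrite big_split /= poch0 !expr0 subn0 !mulr1 !mul1r addrA.
have -> : poch (B * D) y b.+1 + \sum_(i < b.+1)
   (-1) ^+ i.+1 * y ^+ 'C(i.+1, 2) * (y ^+ i.+1 * gbinom y b i.+1) *
   poch B y i.+1 * poch (B * D * y ^+ i.+1) y (b - i) * D ^+ i.+1
 = \sum_(i < b.+1)
   (-1) ^+ i * y ^+ 'C(i, 2) * (y ^+ i * gbinom y b i) *
   poch B y i * poch (B * D * y ^+ i) y (b.+1 - i) * D ^+ i.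
  rewrite [RHS]big_ord_recl big_ord_recr.
  under [in RHS]eq_bigr => i _ do rewrite lift0 subSS.
  rewrite /= gbinom_small // !mulr0 !mul0r addr0.
  by rewrite gbinom0 poch0 !expr0 subn0 !mulr1 !mul1r.
(* [(1 - B D y^i) - D (1 - B y^i) = 1 - D] reduces to the case [b] with [D y] for [D]. *)
rewrite -big_split mulr_sumr /=; apply: eq_bigr => -[i Hi] _ /=.
rewrite subSn // pochSl pochSr binS bin1 !exprS !exprMn !exprD.
have -> : B * (D * y) * y ^+ i = B * D * y ^+ i * y by ring.
have -> : B * D * (y * y ^+ i) = B * D * y ^+ i * y by ring.
by ring.
Qed.

Lemma gbinom_poch (y : K) b l : (l <= b)%N ->
  gbinom y b l * (poch y y l * poch y y (b - l)) = poch y y b.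
Proof.
elim: b l => [|b IH] [|l] // lb; rewrite ?gbinom0 ?poch0 ?subn0 ?mul1r //.
rewrite gbinomS subSS mulrDl.
have e2 := IH l lb.
have -> : gbinom y b l * (poch y y l.+1 * poch y y (b - l))
   = poch y y b * (1 - y ^+ l.+1) by rewrite -e2 pochSr exprS; ring.
move: lb; rewrite ltnS leq_eqVlt => /orP [/eqP -> | lb].
  by rewrite gbinom_small // mulr0 mul0r add0r pochSr exprS.
have e1 := IH l.+1 lb.
rewrite [poch y y b.+1]pochSr.
have -> : (b - l = (b - l.+1).+1)%N by lia.
rewrite [poch y y (b - l.+1).+1]pochSr.
have -> : y ^+ l.+1 * gbinom y b l.+1 *
  (poch y y l.+1 * (poch y y (b - l.+1) * (1 - y * y ^+ (b - l.+1)))) =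
  poch y y b * (y ^+ l.+1 * (1 - y * y ^+ (b - l.+1))) by rewrite -e1; ring.
have -> : y * y ^+ b = y ^+ l.+1 * (y * y ^+ (b - l.+1)).
  by rewrite -!exprS -exprD; congr (_ ^+ _); lia.
by ring.
Qed.

Variable y : K.
Hypothesis y0 : y != 0.
Hypothesis yX : forall k, (0 < k)%N -> y ^+ k != 1.

Lemma poch_expr_neq0 m l : poch (y ^+ m.+1) y l != 0.
Proof.
by apply/prodf_neq0 => i _; rewrite -exprD subr_eq0 eq_sym yX.
Qed.

Lemma poch_neq0 l : poch y y l != 0. Proof. exact: (poch_expr_neq0 0 l). Qed.

(** Pulling -y^(i-b) out of each factor 1 - y^(i-b) leaves (1 - y^b)...(1 - y^(b-l+1)), which is
    [gbinom y b l * poch y y l]. This brings a terminating series to the shape of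
    [q_vandermonde]. *)
Lemma poch_exprVn b l : (l <= b)%N ->
  poch (y ^- b) y l
    = (-1) ^+ l * y ^+ 'C(l, 2) * y ^- (b * l) * gbinom y b l * poch y y l.
Proof.
elim: l => [|l IH] lb.
  by rewrite !poch0 gbinom0 muln0 bin_small // !expr0 invr1 !mulr1.
rewrite pochSr IH 1?ltnW //.
have g1 := gbinom_poch y b _ lb; have g2 := gbinom_poch y b _ (ltnW lb).
have : gbinom y b l.+1 * poch y y l.+1 =
   gbinom y b l * poch y y l * (1 - y ^+ (b - l)).
  apply: (mulIf (poch_neq0 (b - l.+1))); rewrite -!mulrA g1 -g2.
  have -> : (b - l = (b - l.+1).+1)%N by lia.
  by rewrite [poch y y (b - l.+1).+1]pochSr exprS; ring.
rewrite -!mulrA => ->.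
have yb : y ^+ b = y ^+ l * y ^+ (b - l) by rewrite -exprD subnKC // ltnW.
rewrite binS bin1 mulnS [in RHS]exprS !exprD yb.
move: (expf_neq0 l y0) (expf_neq0 (b - l) y0) (expf_neq0 (b * l) y0).
move: (y ^+ l) (y ^+ (b - l)) (y ^+ (b * l)) (y ^+ 'C(l, 2)).
move: (gbinom y b l) (poch y y l) ((-1) ^+ l).
by move=> g q s Y1 Y2 Y3 c n1 n2 n3; field; rewrite n1 n2 n3.
Qed.

Definition poch_ratio (u w : K) (k : nat) : K :=
  poch u y k * poch w y k / (poch y y k) ^+ 2.

Lemma poch_vanish a k : (a < k)%N -> poch (y ^- a) y k = 0.
Proof.
move=> ak; rewrite /poch (bigD1 (Ordinal ak)) //=.
by rewrite mulVf ?expf_neq0 // subrr mul0r.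
Qed.

(** For j > a everything vanishes; for j <= a the sum is q-Vandermonde with B = y^(a+j+1), D = y^-a
    and b = a - j. The two sides are the coefficients of f_j in the theorem when N = 0, where the
    congruence is an equality. *)
Lemma poch_ratio_inversion n a j : (a < n)%N -> (j < n)%N ->
  poch_ratio (y ^- a) (y ^+ a.+1) j =
  (-1) ^+ a * y ^+ 'C(a.+1, 2) * ((-1) ^+ j * y ^+ 'C(j, 2) *
  \sum_(l < n - j) y ^- ((j + l) * j) * poch_ratio (y ^- a) (y ^+ a.+1) (j + l)
       * gauss y (j + l) j).
Proof.
move=> an jn; have [aj|ja] := ltnP a j.
  rewrite {1}/poch_ratio poch_vanish // !mul0r big1 ?mulr0 // => l _.
  by rewrite /poch_ratio poch_vanish ?ltn_addr // !mul0r mulr0 mul0r.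
pose b := (a - j)%N.
have eqa : a = (j + b)%N by rewrite /b; lia.
have V := q_vandermonde y (y ^+ (a + j).+1) (y ^- a) b.
have BD : y ^+ (a + j).+1 * y ^- a = y ^+ j.+1.
  by rewrite -addnS exprD mulrAC mulfV ?mul1r // expf_neq0.
rewrite BD in V.
(* With [k = j + l] the sum is a 2phi1 terminating at [l = b], and [V] sums it. *)
have sE : \sum_(l < n - j)
      y ^- ((j + l) * j) * poch_ratio (y ^- a) (y ^+ a.+1) (j + l) * gauss y (j + l) j
    = y ^- (j * j) * poch_ratio (y ^- a) (y ^+ a.+1) j
      / poch (y ^+ j.+1) y b * poch (y ^- a) y b.
  have -> : (n - j = b.+1 + (n - a.+1))%N by rewrite /b; lia.
  rewrite big_split_ord /= [X in _ + X]big1 ?addr0; last first.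
    move=> l _; rewrite /poch_ratio poch_vanish ?mul0r ?mulr0 ?mul0r //.
    by rewrite /b; lia.
  rewrite -V mulr_sumr; apply: eq_bigr => -[l /= lb] _.
  rewrite ltnS in lb.
  rewrite /poch_ratio /gauss addKn !pochD -!exprD -!exprS.
  have -> : y ^- a * y ^+ j = y ^- b.
    rewrite eqa exprD; field; by rewrite !expf_neq0.
  rewrite (poch_exprVn b l) //.
  have -> : poch (y ^+ j.+1) y b = poch (y ^+ j.+1) y l * poch (y ^+ (j.+1 + l)) y (b - l).
    by rewrite exprD -pochD subnKC.
  have -> : (y ^- a) ^+ l = y ^- (b * l) * y ^- (j * l).
    by rewrite exprVn -exprM -invfM -exprD -mulnDl eqa addnC.
  have -> : y ^- ((j + l) * j) = y ^- (j * j) * y ^- (j * l).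
    by rewrite mulnDl exprD invfM [(l * j)%N]mulnC.
  have N1 := poch_expr_neq0 j l; have N2 := poch_expr_neq0 (j + l) (b - l).
  have N3 := poch_neq0 j; have N4 := poch_neq0 l.
  have M1 := expf_neq0 (j * j) y0; have M2 := expf_neq0 (j * l) y0.
  have M3 := expf_neq0 (b * l) y0.
  rewrite !addSn; field.
  by rewrite ?N1 ?N2 ?N3 ?N4 ?M1 ?M2 ?M3.
rewrite sE.
have -> : poch (y ^- a) y b =
   (-1) ^+ b * (y ^+ 'C(j.+1, 2) / y ^+ 'C(a.+1, 2)) * poch (y ^+ j.+1) y b.
  rewrite {1 2}eqa; move: (b); elim=> [|c IH].
    by rewrite !poch0 expr0 addn0 divff ?mulr1 // expf_neq0.
  rewrite addnS pochSl [in RHS]pochSr.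
  have -> : y ^- (j + c).+1 * y = y ^- (j + c).
    by rewrite exprS; field; rewrite expf_neq0 // y0.
  have -> : y ^+ 'C((j + c).+2, 2) = y ^+ 'C((j + c).+1, 2) * (y * y ^+ (j + c)).
    by rewrite binS bin1 exprD exprS.
  rewrite IH -exprD addSn (exprS y (j + c)) [(-1) ^+ c.+1]exprS.
  by field; rewrite ?expf_neq0 ?y0.
have N1 := poch_expr_neq0 j b.
have M1 := expf_neq0 (j * j) y0; have M2 := expf_neq0 'C(a.+1, 2) y0.
have sg : (-1) ^+ a * (-1) ^+ j * (-1) ^+ b = 1 :> K.
  (* The signs cancel because a + j + b = 2a. *)
  by rewrite -!exprD -signr_odd [in (a + j + b)%N]eqa; have -> : odd (j + b + j + b) = false by lia.
have ex : y ^+ 'C(j, 2) * y ^+ 'C(j.+1, 2) = y ^+ (j * j).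
  rewrite -exprD binS bin1; congr (_ ^+ _).
  by have := mul_bin_diag j 1; rewrite bin1; case: (j) => [|i] //; rewrite ?binS ?bin1 /=; lia.
transitivity (((-1) ^+ a * (-1) ^+ j * (-1) ^+ b)
   * (y ^+ 'C(j, 2) * y ^+ 'C(j.+1, 2)) * y ^- (j * j) * poch_ratio (y ^- a) (y ^+ a.+1) j).
  by rewrite sg ex mul1r divff // mul1r.
by field; rewrite N1 M1 M2.
Qed.

End QSeries.

(** * Z[q] in its fraction field, and its localization at Phi_n *)

Lemma toRFM p q : toRF (p * q) = toRF p * toRF q. Proof. exact: rmorphM. Qed.
Lemma toRFD p q : toRF (p + q) = toRF p + toRF q. Proof. exact: rmorphD. Qed.
Lemma toRFN p : toRF (- p) = - toRF p. Proof. exact: rmorphN. Qed.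
Lemma toRFX p k : toRF (p ^+ k) = toRF p ^+ k. Proof. exact: rmorphXn. Qed.
Lemma toRF1 : toRF 1 = 1. Proof. exact: rmorph1. Qed.
Lemma toRF0 : toRF 0 = 0. Proof. exact: rmorph0. Qed.
Lemma toRF_eq0 p : (toRF p == 0) = (p == 0).
Proof. exact: tofrac_eq0. Qed.

Lemma qq_neq0 : qq != 0. Proof. by rewrite toRF_eq0 polyX_eq0. Qed.

Lemma polyXn_sub1_neq0 m : (0 < m)%N -> 'X^m - 1 != 0 :> {poly int}.
Proof. by move=> m0; rewrite -size_poly_eq0 size_XnsubC. Qed.

Lemma qqX_neq1 m : (0 < m)%N -> qq ^+ m != 1.
Proof.
move=> m0; have := polyXn_sub1_neq0 _ m0.
by rewrite -toRF_eq0 toRFD toRFN toRF1 toRFX subr_eq0.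
Qed.

Section CyclotomicLocalRing.

Variable n : nat.
Hypothesis n_gt1 : (1 < n)%N.

(* Nonvanishing at all primitive [n]-th roots of unity is coprimality to [Phi_n];
   [phi_integral] below is then the localization of [Z[q]] at these [Q]. *)
Definition phi_unit (Q : {poly int}) : Prop :=
  forall z : algC, n.-primitive_root z -> (map_poly intr Q).[z] != 0.

(** Coprimality is unchanged by extension from the rationals to [algC], where it means having no
    common root, and the roots of Phi_n there are the primitive n-th roots of unity. *)
Lemma phi_unit_coprimep Q : phi_unit Q ->
  coprimep (map_poly (intr : int -> rat) Q) (map_poly (intr : int -> rat) 'Phi_n).
Proof.
move=> uQ; rewrite -(coprimep_map (@ratr algC)) coprimep_sym.
rewrite -!map_poly_comp.
have ext p : map_poly (@ratr algC \o (intr : int -> rat)) p = map_poly (intr : int -> algC) p.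
  by apply: eq_map_poly => b; rewrite /= ratr_int.
rewrite !ext; apply/Pdiv.ClosedField.coprimepP => x.
have [z pz] := C_prim_root_exists (ltnW n_gt1).
by rewrite (Cintr_Cyclotomic pz) root_cyclotomic // => /uQ.
Qed.

Lemma phi_unit1 : phi_unit 1.
Proof. by move=> z _; rewrite rmorph1 hornerC oner_neq0. Qed.

Lemma phi_unitM P Q : phi_unit P -> phi_unit Q -> phi_unit (P * Q).
Proof. by move=> uP uQ z pz; rewrite rmorphM hornerM mulf_neq0 ?uP ?uQ. Qed.

Lemma phi_unit_neq0 Q : phi_unit Q -> toRF Q != 0.
Proof.
move=> uQ; rewrite toRF_eq0; apply/eqP => Q0.
have [z /uQ] := C_prim_root_exists (ltnW n_gt1).
by rewrite Q0 rmorph0 horner0 eqxx.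
Qed.

Lemma phi_unitX : phi_unit 'X.
Proof.
move=> z pz; rewrite map_polyX hornerX; apply/eqP => z0.
by have := prim_expr_order pz; rewrite z0 expr0n; case: n n_gt1 => [|?] // _ /eqP;
  rewrite eq_sym oner_eq0.
Qed.

Lemma phi_unitXn_sub1 m : ~~ (n %| m)%N -> phi_unit ('X^m - 1).
Proof.
move=> ndm z pz; rewrite rmorphB rmorph1 /= map_polyXn hornerD hornerN hornerXn hornerC.
by rewrite subr_eq0 -(prim_order_dvd pz).
Qed.

(** A nonzero constant has no roots, so the localization contains 1/d, as the interpolation between
    N = 0 and N = d requires. *)
Lemma phi_unit_nat d : (0 < d)%N -> phi_unit d%:R.
Proof.
by move=> d0 z _; rewrite rmorph_nat -polyC_natr hornerC pnatr_eq0 -lt0n.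
Qed.

Definition phi_integral (u : RF) : Prop :=
  exists P Q, phi_unit Q /\ u = toRF P / toRF Q.

Lemma phi_integral_toRF P : phi_integral (toRF P).
Proof. by exists P, 1; split; [exact: phi_unit1 | rewrite toRF1 divr1]. Qed.

Lemma phi_integral_inv Q : phi_unit Q -> phi_integral (toRF Q)^-1.
Proof. by exists 1, Q; rewrite toRF1 mul1r. Qed.

Lemma phi_integral0 : phi_integral 0.
Proof. by rewrite -toRF0; exact: phi_integral_toRF. Qed.

Lemma phi_integral1 : phi_integral 1.
Proof. by rewrite -toRF1; exact: phi_integral_toRF. Qed.

Lemma phi_integralM u v : phi_integral u -> phi_integral v -> phi_integral (u * v).
Proof.
move=> [P [Q [uQ ->]]] [P' [Q' [uQ' ->]]]; exists (P * P'), (Q * Q').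
by split; [exact: phi_unitM | rewrite !toRFM mulf_div].
Qed.

Lemma phi_integralN u : phi_integral u -> phi_integral (- u).
Proof. by move=> [P [Q [uQ ->]]]; exists (- P), Q; rewrite toRFN mulNr. Qed.

Lemma phi_integralD u v : phi_integral u -> phi_integral v -> phi_integral (u + v).
Proof.
move=> [P [Q [uQ ->]]] [P' [Q' [uQ' ->]]]; exists (P * Q' + P' * Q), (Q * Q').
split; first exact: phi_unitM.
by rewrite toRFD !toRFM addf_div // phi_unit_neq0.
Qed.

Lemma phi_integralX u k : phi_integral u -> phi_integral (u ^+ k).
Proof.
move=> iu; elim: k => [|k IH]; first exact: phi_integral1.
by rewrite exprS; exact: phi_integralM.
Qed.

Lemma phi_integral_sum (I : Type) (s : seq I) (F : I -> RF) :
  (forall i, phi_integral (F i)) -> phi_integral (\sum_(i <- s) F i).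
Proof.
move=> iF; apply: big_ind => //; [exact: phi_integral0 | exact: phi_integralD].
Qed.

Lemma phi_integral_qq : phi_integral qq.
Proof. exact: phi_integral_toRF. Qed.

Lemma phi_integral_qqV : phi_integral qq^-1.
Proof. exact: (phi_integral_inv _ phi_unitX). Qed.

Lemma phi_integral_int (m : int) : phi_integral m%:~R.
Proof.
by rewrite -(rmorph_int (@tofrac {poly int})); exact: phi_integral_toRF.
Qed.

Definition phi : RF := toRF 'Phi_n.

Lemma phi_integral_phi : phi_integral phi.
Proof. exact: phi_integral_toRF. Qed.

Definition cong2 (u : RF) : Prop := exists2 w, phi_integral w & u = phi ^+ 2 * w.

Lemma cong2_congPhi2 A B : cong2 (A - B) -> congPhi2 n A B.
Proof.
move=> [w [P [Q [uQ ->]]] eAB]; exists P, Q; split; first exact: phi_unit_coprimep.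
by rewrite eAB mulrA.
Qed.

Lemma cong2M u v : phi_integral u -> cong2 v -> cong2 (u * v).
Proof.
move=> iu [w iw ->]; exists (u * w); first exact: phi_integralM.
by rewrite mulrCA.
Qed.

Lemma cong2D u v : cong2 u -> cong2 v -> cong2 (u + v).
Proof.
move=> [w iw ->] [w' iw' ->]; exists (w + w'); first exact: phi_integralD.
by rewrite mulrDr.
Qed.

Lemma cong2_sum (I : Type) (s : seq I) (P : pred I) (F : I -> RF) :
  (forall i, P i -> cong2 (F i)) -> cong2 (\sum_(i <- s | P i) F i).
Proof.
move=> cF; apply: big_ind => //; last exact: cong2D.
by exists 0; [exact: phi_integral0 | rewrite mulr0].
Qed.

(** Only [R] may depend on [N]. Products keep this form because their N^2 term carries the factor
    [phi ^+ 2] and is absorbed into [R]. *)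
Definition affine_mod (g : int -> RF) : Prop :=
  exists A B, [/\ phi_integral A, phi_integral B &
    forall N : int, exists2 R, phi_integral R
      & g N = A + B * N%:~R * phi + phi ^+ 2 * R].

Lemma affine_mod_ext g h : g =1 h -> affine_mod g -> affine_mod h.
Proof.
move=> gh [A [B [iA iB gE]]]; exists A, B; split=> // N.
by rewrite -gh; exact: gE.
Qed.

Lemma affine_mod_cst c : phi_integral c -> affine_mod (fun=> c).
Proof.
move=> ic; exists c, 0; split=> // [|N]; first exact: phi_integral0.
by exists 0; [exact: phi_integral0 | ring].
Qed.

Ltac integral := repeat first [assumption | exact: phi_integral_phi
  | exact: phi_integral_int | apply: phi_integralD | apply: phi_integralN
  | apply: phi_integralM | apply: phi_integralX | exact: phi_integral1].

Lemma affine_modD g h : affine_mod g -> affine_mod h ->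
  affine_mod (fun N => g N + h N).
Proof.
move=> [A [B [iA iB gE]]] [A' [B' [iA' iB' hE]]]; exists (A + A'), (B + B').
split=> [||N]; [integral|integral|].
have [R iR ->] := gE N; have [R' iR' ->] := hE N; exists (R + R'); first by integral.
by ring.
Qed.

Lemma affine_modM g h : affine_mod g -> affine_mod h ->
  affine_mod (fun N => g N * h N).
Proof.
move=> [A [B [iA iB gE]]] [A' [B' [iA' iB' hE]]].
exists (A * A'), (A * B' + B * A'); split=> [||N]; [integral|integral|].
have [R iR ->] := gE N; have [R' iR' ->] := hE N.
exists (A * R' + R * A' + B * N%:~R * (B' * N%:~R)
  + phi * (B * N%:~R * R' + R * (B' * N%:~R)) + phi ^+ 2 * R * R').
  by integral.
by ring.
Qed.

Lemma affine_modN g : affine_mod g -> affine_mod (fun N => - g N).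
Proof.
move=> ag; apply: (affine_mod_ext (fun N => (-1) * g N)) => [N|].
  by rewrite mulN1r.
by apply: affine_modM => //; apply: affine_mod_cst; integral.
Qed.

Lemma affine_mod_scale g (m : int) : affine_mod g -> affine_mod (fun N => g (m * N)).
Proof.
move=> [A [B [iA iB gE]]]; exists A, (B * m%:~R); split=> [||N]; [by []|integral|].
by have [R iR ->] := gE (m * N); exists R => //; rewrite intrM; ring.
Qed.

Lemma affine_mod_sum (I : Type) (s : seq I) (F : I -> int -> RF) :
  (forall i, affine_mod (F i)) -> affine_mod (fun N => \sum_(i <- s) F i N).
Proof.
move=> aF; elim: s => [|i s IH].
  apply: (affine_mod_ext (fun=> 0)) => [N|]; first by rewrite big_nil.
  exact: affine_mod_cst phi_integral0.
apply: (affine_mod_ext (fun N => F i N + \sum_(j <- s) F j N)) => [N|].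
  by rewrite big_cons.
exact: affine_modD.
Qed.

(** First-order binomial expansion of (1 + phi w)^N, by induction in both directions from N = 0; the
    downward step divides by [v]. *)
Lemma affine_mod_exp v w : v != 0 -> phi_integral v^-1 -> phi_integral w ->
  v = 1 + phi * w -> affine_mod (fun N => v ^ N).
Proof.
move=> v0 iV iw vE; exists 1, w; split=> //; first exact: phi_integral1.
have up N : (exists2 R, phi_integral R & v ^ N = 1 + w * N%:~R * phi + phi ^+ 2 * R) ->
  exists2 R, phi_integral R & v ^ (N + 1) = 1 + w * (N + 1)%:~R * phi + phi ^+ 2 * R.
  move=> [R iR e]; exists (w * w * N%:~R + R * (1 + phi * w)); first by integral.
  by rewrite expfzDr // expr1z e {1}vE intrD; ring.
have dn N : (exists2 R, phi_integral R & v ^ N = 1 + w * N%:~R * phi + phi ^+ 2 * R) ->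
  exists2 R, phi_integral R & v ^ (N - 1) = 1 + w * (N - 1)%:~R * phi + phi ^+ 2 * R.
  (* Multiplying the expansion at N - 1 by 1 + phi w creates the term w^2 (N-1) phi^2, which the
     witness compensates. *)
  move=> [R iR e]; exists (v^-1 * (R - w * w * (N - 1)%:~R)); first by integral.
  rewrite expfzDr // -invr_expz expr1z e intrB.
  apply: (mulIf v0); rewrite mulfVK // mulrDl [v^-1 * _]mulrC mulrA mulfVK //.
  by rewrite vE; ring.
elim/int_rec => [|m|m].
- by exists 0; [exact: phi_integral0 | rewrite expr0z; ring].
- by move/up; rewrite intS addrC.
- by move/dn; rewrite intS opprD addrC.
Qed.

(** The value at 0 makes [A] a multiple of [phi ^+ 2], the value at [d] then makes [d * B * phi]
    one, and [d] is invertible. Solving for [B * phi] rather than [B] avoids cancelling [phi]. *)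
Lemma affine_mod_eq0 g d : (0 < d)%N -> affine_mod g -> g 0 = 0 -> g d = 0 ->
  forall N, cong2 (g N).
Proof.
move=> d0 [A [B [iA iB gE]]] g0 gd N.
have [R0 iR0] := gE 0; rewrite g0 => e0.
have [Rd iRd] := gE d; rewrite gd => ed.
have [R iR ->] := gE N.
have du : (d%:~R : RF) = toRF d%:R by rewrite /toRF rmorph_nat.
have dn0 : (d%:~R : RF) != 0 by rewrite du phi_unit_neq0 //; exact: phi_unit_nat.
have iV : phi_integral (d%:~R)^-1.
  by rewrite du; apply: phi_integral_inv; exact: phi_unit_nat.
exists (- R0 + N%:~R * (d%:~R)^-1 * (R0 - Rd) + R); first by integral.
have eA : A = - (phi ^+ 2 * R0).
  by apply/eqP; rewrite -addr_eq0 eq_sym {1}e0 mulr0 mul0r addr0.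
have eB : B * phi = (d%:~R)^-1 * (phi ^+ 2 * R0 - phi ^+ 2 * Rd).
  apply: (mulfI dn0); rewrite mulVKf //.
  apply/eqP; rewrite -subr_eq0 [X in _ == X]ed eA; apply/eqP; ring.
have -> : B * N%:~R * phi = B * phi * N%:~R by ring.
by rewrite eB eA; ring.
Qed.

Lemma phi_dvd_qqn : exists2 w, phi_integral w & qq ^+ n - 1 = phi * w.
Proof.
have n0 := ltnW n_gt1.
have := prod_Cyclotomic n0; rewrite (big_rem n) /=; last first.
  by rewrite -dvdn_divisors.
move=> e; exists (toRF (\prod_(y <- rem n (divisors n)) 'Phi_y)).
  exact: phi_integral_toRF.
by rewrite -toRFM e toRFD toRFN toRF1 toRFX.
Qed.

(** In q^n - 1 = (q^(n/2) - 1)(q^(n/2) + 1) the first factor is a unit, as n does not divide n/2, so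
    Phi_n divides the second. *)
Lemma phi_dvd_qqhalf : ~~ odd n ->
  exists2 w, phi_integral w & - qq ^+ n./2 = 1 + phi * w.
Proof.
move=> en; have [w iw wE] := phi_dvd_qqn.
have u : phi_unit ('X^(n./2) - 1).
  by apply: phi_unitXn_sub1; apply/negP => /dvdn_leq; lia.
have := phi_unit_neq0 _ u; have := phi_integral_inv _ u.
rewrite toRFD toRFN toRF1 toRFX -/qq; set h := qq ^+ n./2 => iV h1.
exists (- (w / (h - 1))); first by integral.
have : (h + 1) * (h - 1) = phi * w.
  by rewrite -wE -[in RHS](even_halfK en) -muln2 exprM -/h; move: (h) => u'; ring.
move=> e; apply: (mulIf h1); rewrite [RHS]mulrDl mul1r mulrN mulNr mulrA -e mulfK //.
by move: (h) => u'; ring.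
Qed.

End CyclotomicLocalRing.

(** * Exchange of summation, and the parameters as functions of N *)

Lemma exchange_triangle (V : nmodType) n (G : nat -> nat -> V) :
  \sum_(k < n) \sum_(j < k.+1) G k j = \sum_(j < n) \sum_(l < n - j) G (j + l)%N j.
Proof.
elim: n => [|n IH]; first by rewrite !big_ord0.
rewrite big_ord_recr IH [RHS]big_ord_recr subSnn big_ord1 addn0 /=.
rewrite big_ord_recr addrA; congr (_ + _).
rewrite -big_split; apply: eq_bigr => -[j jn] _ /=.
by rewrite subSn 1?ltnW // big_ord_recr /= subnKC // ltnW.
Qed.

(** Exchanging q^r and q^(d-r) lets the case N = d be treated as the case N = 0 with n-1-a in place
    of a. *)
Lemma poch_ratioC (K : fieldType) (y u w : K) k : poch_ratio K y u w k = poch_ratio K y w u k.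
Proof. by rewrite /poch_ratio [poch K u y k * _]mulrC. Qed.

Lemma twist_term (K : fieldType) (y c g v : K) (j m : nat) : y != 0 ->
  c * ((-1) ^+ j * y ^ ('C(j, 2)%:Z - m%:Z) * g * v) =
  v * ((-1) ^+ j * y ^+ 'C(j, 2) * (y ^- m * c * g)).
Proof. by move=> y0; rewrite expfzDr // -invr_expz -!exprnP; ring. Qed.

Section ComplementaryExponents.

Variables (K : fieldType) (y V : K) (n d a : nat).
Hypotheses (y0 : y != 0) (an : (a < n)%N) (Vd : V ^+ d = y ^+ n).

(** With V = q^n and a' = n-1-a, this and [expr_complementV] turn the parameters at N = d into
    y^(a'+1) and y^-a', the terminating pair for a' in the opposite order. *)
Lemma exprV_complement : y ^- a * V ^ d = y ^+ (n - a.+1).+1.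
Proof.
have e : (a + (n - a.+1).+1 = n)%N by lia.
by rewrite -exprnP Vd -{1}e exprD mulKf // expf_neq0.
Qed.

Lemma expr_complementV : y ^+ a.+1 * V ^ (- d%:Z) = y ^- (n - a.+1).
Proof.
rewrite -invr_expz -exprnP Vd -{1}(subnKC an) exprD invfM mulVKf //.
by rewrite expf_neq0.
Qed.

End ComplementaryExponents.

Section IntegerPowers.

Variables (K : fieldType) (q : K) (n d a : nat) (N r : int).
Hypotheses (q0 : q != 0) (rE : r = N * n%:Z - a%:Z * d%:Z).

Lemma exprz_exprn m (z : int) : (q ^+ m) ^ z = q ^ (m%:Z * z).
Proof. by rewrite exprnP exprz_exp. Qed.

Lemma exprz_lattice : q ^ r = (q ^+ d) ^- a * (q ^+ n) ^ N.
Proof.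
rewrite -exprM exprnP invr_expz exprz_exprn -expfzDr // rE; congr (q ^ _).
by rewrite PoszM; ring.
Qed.

Lemma exprz_lattice_compl :
  q ^ (d%:Z - r) = (q ^+ d) ^+ a.+1 * (q ^+ n) ^ (- N).
Proof.
rewrite -exprM exprnP exprz_exprn -expfzDr // rE; congr (q ^ _).
by rewrite PoszM intS; ring.
Qed.

End IntegerPowers.

(** * The congruence, coefficient by coefficient *)

Section Congruence.

Variables n d a : nat.
Hypothesis n_gt1 : (1 < n)%N.
Hypothesis d_gt0 : (0 < d)%N.
Hypothesis co_nd : coprime n d.
Hypothesis a_lt_n : (a < n)%N.

Local Notation y := (qq ^+ d).
Local Notation integral := (phi_integral n).
Local Notation affine := (affine_mod n).

Let y0 : y != 0. Proof. by rewrite expf_neq0 // qq_neq0. Qed.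

Let yX k : (0 < k)%N -> y ^+ k != 1.
Proof. by move=> k0; rewrite -exprM qqX_neq1 // muln_gt0 d_gt0. Qed.

Let integral_y : integral y.
Proof. exact/phi_integralX/phi_integral_qq. Qed.

Let integral_yV m : integral (y ^- m).
Proof. by rewrite -exprM -exprVn; exact: phi_integralX (phi_integral_qqV n n_gt1). Qed.

Ltac integral := repeat first [assumption | exact: integral_y
  | exact: integral_yV | exact: phi_integral1 | exact: phi_integral_int
  | apply: (phi_integralD n n_gt1) | apply: phi_integralN
  | apply: phi_integralX | apply: phi_integralM].

(** For 1 <= i <= k < n, coprimality of n and d shows that n does not divide d i, so each factor 1 -
    q^(d i) is a unit of the localization. *)
Lemma integral_pochV k : (k < n)%N -> integral (poch _ y y k)^-1.
Proof.
move=> kn; suff [Q uQ <-] : exists2 Q, phi_unit n Q & toRF Q = poch _ y y k.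
  exact: phi_integral_inv.
elim: k kn => [|k IH] kn.
  by exists 1; [exact: phi_unit1 | rewrite poch0 toRF1].
have [Q uQ eQ] := IH (ltnW kn).
exists (Q * (-1 * ('X^(d * k.+1) - 1))).
  apply: phi_unitM => //; apply: phi_unitM.
    by move=> z _; rewrite rmorphN1 hornerN hornerC oppr_eq0 oner_neq0.
  apply: phi_unitXn_sub1; rewrite Gauss_dvdr //.
  by apply/negP => /(dvdn_leq (ltn0Sn k)); rewrite leqNgt kn.
rewrite !toRFM toRFD !toRFN toRF1 toRFX eQ pochSr -exprS exprM.
by congr (_ * _); rewrite -/qq; ring.
Qed.

Lemma affine_poch u g k : integral u -> affine g ->
  affine (fun N => poch _ (u * g N) y k).
Proof.
move=> iu ag; elim: k => [|k IH].
  apply: (affine_mod_ext n (fun=> 1)) => [N|]; first by rewrite poch0.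
  by apply: affine_mod_cst; integral.
apply: (affine_mod_ext n (fun N => poch _ (u * g N) y k * (1 + (- (u * y ^+ k)) * g N))) => [N|].
  by rewrite pochSr; congr (_ * _); rewrite mulNr mulrAC.
apply: affine_modM => //; apply: affine_modD => //.
  by apply: affine_mod_cst; integral.
apply: affine_modM => //; by apply: affine_mod_cst; integral.
Qed.

Lemma integral_evalRF p : integral (evalRF p y).
Proof.
rewrite /evalRF horner_coef; apply: phi_integral_sum => // i.
apply: phi_integralM; last by integral.
by rewrite coef_map; exact: phi_integral_int.
Qed.

Lemma integral_poch m k : integral (poch _ (y ^+ m) y k).
Proof.
elim: k => [|k IH]; first by rewrite poch0; exact: phi_integral1.
by rewrite pochSr; integral.
Qed.

Let V : RF := qq ^+ n.

Let V0 : V != 0. Proof. exact: (expf_neq0 n qq_neq0). Qed.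

Lemma affine_V : affine (fun N => V ^ N).
Proof.
have [w iw e] := phi_dvd_qqn n n_gt1.
apply: (affine_mod_exp n n_gt1 V w) => //.
  by rewrite /V -exprVn; exact: phi_integralX (phi_integral_qqV n n_gt1).
by rewrite -e /V addrC subrK.
Qed.

(* The coefficient [coefk d r] at [q^r = y^-a (q^n)^N]. *)
Let cN (N : int) k := poch_ratio _ y (y ^- a * V ^ N) (y ^+ a.+1 * V ^ (- N)) k.

Let affine_cN k : (k < n)%N -> affine (fun N => cN N k).
Proof.
move=> kn; apply: affine_modM => //.
  apply: affine_modM => //.
    by apply: affine_poch; [integral | exact: affine_V].
  apply: affine_poch; first by integral.
  apply: (affine_mod_ext n (fun N => V ^ (-1 * N))) => [N|]; first by rewrite mulN1r.
  exact: (affine_mod_scale n (exprz V) (-1) affine_V).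
apply: affine_mod_cst; rewrite -exprVn; apply: phi_integralX; exact: integral_pochV.
Qed.

(** [zz] is the N-dependent power in the prefactor, kept abstract so that both parities of n share
    the argument. Its values at 0 and d make the prefactor that of [poch_ratio_inversion] for a and
    for n-1-a respectively. *)
Lemma cong2_main (f : nat -> {poly int}) (zz : int -> RF) (N : int) :
  affine zz -> zz 0 = 1 ->
  (-1) ^+ a * y ^+ 'C(a.+1, 2) * zz d
    = (-1) ^+ (n - a.+1) * y ^+ 'C((n - a.+1).+1, 2) ->
  cong2 n (\sum_(k < n) cN N k * evalRF (f k) y
     - (-1) ^+ a * y ^+ 'C(a.+1, 2) * zz N * \sum_(k < n) cN N k * ftilde f k y).
Proof.
move=> azz zz0 zzd.
(* After the substitution k = j + l, [D j M] is the difference of the coefficients of f_j on the two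
   sides; [M] stays free for the interpolation between 0 and d. *)
pose S j M := \sum_(l < n - j) y ^- ((j + l) * j) * cN M (j + l) * gauss _ y (j + l) j.
pose D j M := cN M j - (-1) ^+ a * y ^+ 'C(a.+1, 2) * zz M
   * ((-1) ^+ j * y ^+ 'C(j, 2) * S j M).
have -> : \sum_(k < n) cN N k * ftilde f k y =
   \sum_(j < n) evalRF (f j) y * ((-1) ^+ j * y ^+ 'C(j, 2) * S j N).
  under eq_bigr => k _ do rewrite /ftilde mulr_sumr.
  rewrite (exchange_triangle _ n (fun k j => cN N k * ((-1) ^+ j * y ^ ('C(j, 2)%:Z - (k * j)%:Z) *
      qbinom y k j * evalRF (f j) y))).
  apply: eq_bigr => -[j jn] _ /=; rewrite /S !mulr_sumr; apply: eq_bigr => -[l ln] _ /=.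
  exact: (@twist_term _ y _ _ _ j ((j + l) * j) y0).
rewrite mulr_sumr -sumrB; apply: cong2_sum => // -[j jn] _ /=.
have -> : cN N j * evalRF (f j) y - (-1) ^+ a * y ^+ 'C(a.+1, 2) * zz N *
   (evalRF (f j) y * ((-1) ^+ j * y ^+ 'C(j, 2) * S j N)) = evalRF (f j) y * D j N.
  rewrite /D; move: (cN N j) (evalRF _ _) (_ * zz N) (_ * S j N).
  by move=> c v z s; ring.
apply: cong2M => //; first exact: integral_evalRF.
apply: (affine_mod_eq0 n n_gt1 (D j) d d_gt0).
- apply: affine_modD => //; first exact: affine_cN.
  apply: affine_modN => //; apply: affine_modM => //.
    by apply: affine_modM => //; apply: affine_mod_cst; integral.
  apply: affine_modM => //.
    by apply: affine_mod_cst; integral.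
  apply: affine_mod_sum => // -[l ln] /=.
  have jln : (j + l < n)%N by lia.
  apply: affine_modM => //.
    apply: affine_modM => //; last exact: affine_cN.
    by apply: affine_mod_cst; integral.
  apply: affine_mod_cst; apply: phi_integralM => //; first exact: (integral_poch 1).
  by rewrite invfM; apply: phi_integralM => //; apply: integral_pochV; lia.
- rewrite /D /S /cN oppr0 expr0z !mulr1 zz0 mulr1.
  by rewrite {1}(poch_ratio_inversion _ y y0 yX n a j) // subrr.
(* The value at M = d: the parameters are the terminating pair for n-1-a, swapped. *)
have Vd : V ^+ d = y ^+ n by exact: (exprAC qq n d).
have eu := exprV_complement _ y V n d a y0 a_lt_n Vd.
have ew := expr_complementV _ y V n d a y0 a_lt_n Vd.
rewrite /D /S /cN eu ew zzd poch_ratioC.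
under eq_bigr => l _ do rewrite poch_ratioC.
by rewrite {1}(poch_ratio_inversion _ y y0 yX n (n - a.+1) j) ?subrr //; lia.
Qed.

Lemma congPhi2_main (f : nat -> {poly int}) (zz : int -> RF) (r N : int) (c : RF) :
  affine zz -> zz 0 = 1 ->
  (-1) ^+ a * y ^+ 'C(a.+1, 2) * zz d
    = (-1) ^+ (n - a.+1) * y ^+ 'C((n - a.+1).+1, 2) ->
  r = N * n%:Z - a%:Z * d%:Z -> c = (-1) ^+ a * y ^+ 'C(a.+1, 2) * zz N ->
  congPhi2 n (\sum_(k < n) coefk d r k * evalRF (f k) y)
    (c * \sum_(k < n) coefk d r k * ftilde f k y).
Proof.
move=> azz zz0 zzd rE ->; apply: (cong2_congPhi2 n n_gt1).
have H := cong2_main f zz N azz zz0 zzd.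
rewrite /cN in H.
rewrite -(exprz_lattice _ qq n d a N r qq_neq0 rE) in H.
rewrite -(exprz_lattice_compl _ qq n d a N r qq_neq0 rE) in H.
exact: H.
Qed.

End Congruence.

(** * Signs and exponents of the prefactor *)

Lemma double_bin2 k : ('C(k.+1, 2) * 2 = k.+1 * k)%N.
Proof. by elim: k => // k; rewrite [in 'C(k.+2, 2)]binS bin1; lia. Qed.

(** The shift of the binomial exponent from a to n-1-a is n(n-1-2a)/2; it is doubled here because
    n-1-2a may be odd. *)
Lemma bin2_complement (n a : nat) : (a < n)%N ->
  2 * 'C((n - a.+1).+1, 2)%:Z
    = 2 * 'C(a.+1, 2)%:Z + n%:Z * (n%:Z - 1 - 2 * a%:Z).
Proof.
move=> an; have := double_bin2 a; have := double_bin2 (n - a.+1).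
move: 'C(a.+1, 2) 'C((n - a.+1).+1, 2) => x y.
have -> : ((n - a.+1).+1 = n - a)%N by lia.
nia.
Qed.

Lemma exprN1z_odd (K : fieldType) (s N : int) :
  (-1) ^ ((2 * s + 1) * N) = (-1) ^ N :> K.
Proof.
have n0 : (-1 : K) != 0 by rewrite oppr_eq0 oner_neq0.
rewrite mulrDl mul1r -mulrA expfzDr // -exprz_exp.
by rewrite (_ : (-1) ^ (2 : int) = 1) ?exp1rz ?mul1r // -exprnP sqrrN expr1n.
Qed.

Section Prefactors.

Variables (K : fieldType) (q : K) (n d a : nat).
Hypotheses (q0 : q != 0) (an : (a < n)%N).

(** For odd n, a and n-1-a have the same parity, so the signs agree and the powers of q^n account
    for the whole shift of exponent. *)
Lemma odd_prefactor_at_d (m : int) : odd n -> n%:Z - 1 - 2 * a%:Z = 2 * m ->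
  (-1) ^+ a * (q ^+ d) ^+ 'C(a.+1, 2) * (q ^+ n) ^ (m * d%:Z)
    = (-1) ^+ (n - a.+1) * (q ^+ d) ^+ 'C((n - a.+1).+1, 2).
Proof.
move=> on mE; rewrite -mulrA; congr (_ * _).
  by rewrite -[LHS]signr_odd -[RHS]signr_odd; congr (_ ^+ (nat_of_bool _)); lia.
rewrite -!exprM !exprnP !exprz_exp -expfzDr //; congr (q ^ _).
have b : 'C((n - a.+1).+1, 2)%:Z = 'C(a.+1, 2)%:Z + n%:Z * m.
  by have := bin2_complement n a an; nia.
by rewrite !PoszM b; ring.
Qed.

Lemma odd_prefactor (m N : int) : n%:Z - 1 - 2 * a%:Z = 2 * m ->
  (-1) ^+ a * q ^ ((d * 'C(a.+1, 2))%:Z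
     + ((N * n%:Z * (n%:Z - 1 - 2 * a%:Z)) %/ 2)%Z)
  = (-1) ^+ a * (q ^+ d) ^+ 'C(a.+1, 2) * (q ^+ n) ^ (m * N).
Proof.
move=> mE; rewrite -[RHS]mulrA; congr (_ * _).
have -> : (N * n%:Z * (n%:Z - 1 - 2 * a%:Z) = N * n%:Z * m * 2)%Z by nia.
rewrite mulzK // -exprM !exprnP exprz_exp -expfzDr //.
by congr (q ^ _); ring.
Qed.

(** For even n, a and n-1-a have opposite parities. Since t and d are odd, the sign in the base -q^h
    contributes (-1)^(t d) = -1 and makes up for this. *)
Lemma even_prefactor_at_d (t s : int) (h : nat) : n = h.*2 -> odd d ->
  n%:Z - 1 - 2 * a%:Z = t -> t = 2 * s + 1 ->
  (-1) ^+ a * (q ^+ d) ^+ 'C(a.+1, 2) * (- q ^+ h) ^ (t * d%:Z)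
    = (-1) ^+ (n - a.+1) * (q ^+ d) ^+ 'C((n - a.+1).+1, 2).
Proof.
move=> nE od tE ts; rewrite -[- q ^+ h]mulN1r expfzMl {1}ts exprN1z_odd.
rewrite mulrACA -exprnP -exprD; congr (_ * _).
  by rewrite -[LHS]signr_odd -[RHS]signr_odd; congr (_ ^+ (nat_of_bool _)); lia.
rewrite -!exprM !exprnP !exprz_exp -expfzDr //; congr (q ^ _).
have b : 'C((n - a.+1).+1, 2)%:Z = 'C(a.+1, 2)%:Z + h%:Z * t.
  by have := bin2_complement n a an; nia.
by rewrite !PoszM b; ring.
Qed.

(** As t is odd, the base -q^h contributes (-1)^(t N) = (-1)^N, which is the extra sign
    (-1)^((ad+r)/n) of the even case. *)
Lemma even_prefactor (t s N : int) (h : nat) : n = h.*2 ->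
  n%:Z - 1 - 2 * a%:Z = t -> t = 2 * s + 1 ->
  (-1) ^ (a%:Z + N) * q ^ ((d * 'C(a.+1, 2))%:Z
     + ((N * n%:Z * (n%:Z - 1 - 2 * a%:Z)) %/ 2)%Z)
  = (-1) ^+ a * (q ^+ d) ^+ 'C(a.+1, 2) * (- q ^+ h) ^ (t * N).
Proof.
move=> nE tE ts; rewrite -[- q ^+ h]mulN1r expfzMl {1}ts exprN1z_odd.
rewrite expfzDr ?oppr_eq0 ?oner_neq0 // [RHS]mulrACA; congr (_ * _).
have -> : (N * n%:Z * (n%:Z - 1 - 2 * a%:Z) = N * h%:Z * t * 2)%Z.
  by rewrite nE in tE *; nia.
rewrite mulzK // -exprM !exprnP exprz_exp -expfzDr //.
by congr (q ^ _); ring.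
Qed.

End Prefactors.

Theorem theorem1p2 (n d : nat) (r : int) (f : nat -> {poly int}) (a : nat) :
  (2 <= n)%N -> (1 <= d)%N -> coprime n d ->
  (a < n)%N -> ((n%:Z) %| (a%:Z * d%:Z + r))%Z ->
  let e : int := (d * 'C(a.+1, 2))%:Z
                 + (((a%:Z * d%:Z + r) * (n%:Z - 1 - 2 * a%:Z)) %/ 2)%Z in
  (odd n ->
    congPhi2 n (\sum_(k < n) coefk d r k * evalRF (f k) (qq ^+ d))
      ((-1) ^+ a * qq ^ e *
        \sum_(k < n) coefk d r k * ftilde f k (qq ^+ d)))
  /\
  (~~ odd n ->
    congPhi2 n (\sum_(k < n) coefk d r k * evalRF (f k) (qq ^+ d))
      ((-1) ^ (a%:Z + ((a%:Z * d%:Z + r) %/ n%:Z)%Z) * qq ^ e *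
        \sum_(k < n) coefk d r k * ftilde f k (qq ^+ d))).
Proof.
move=> n2 d1 co an nN e.
set N := ((a%:Z * d%:Z + r) %/ n%:Z)%Z.
have NE : a%:Z * d%:Z + r = N * n%:Z by rewrite /N divzK.
have rE : r = N * n%:Z - a%:Z * d%:Z by rewrite -NE; ring.
rewrite /e NE; split=> [on|en].
  have [m mE] : exists m : int, n%:Z - 1 - 2 * a%:Z = 2 * m.
    by exists ((n./2)%:Z - a%:Z); lia.
  apply: (congPhi2_main n d a n2 d1 co an f (fun M => (qq ^+ n) ^ (m * M)) r N) => //.
  - exact: (affine_mod_scale n _ m (affine_V n n2)).
  - by rewrite mulr0 expr0z.
  - exact: (odd_prefactor_at_d _ qq n d a qq_neq0 an m on mE).
  - exact: (odd_prefactor _ qq n d a qq_neq0 an m N mE).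
(* An even n coprime to d forces d to be odd, which the sign comparison at N = d needs. *)
have od : odd d.
  by move: co; rewrite -[n](even_halfK en) -muln2 coprimeMl coprime2n => /andP[].
have nh : n = (n./2).*2 by rewrite even_halfK.
have tE : n%:Z - 1 - 2 * a%:Z = 2 * ((n./2)%:Z - a%:Z - 1) + 1 by lia.
have [w iw wE] := phi_dvd_qqhalf n n2 en.
apply: (congPhi2_main n d a n2 d1 co an f
  (fun M => (- qq ^+ n./2) ^ ((n%:Z - 1 - 2 * a%:Z) * M)) r N) => //.
- apply: (affine_mod_scale n (fun M => (- qq ^+ n./2) ^ M)).
  apply: (affine_mod_exp n n2 _ w) => //.
    by rewrite oppr_eq0; exact: (expf_neq0 _ qq_neq0).
  rewrite invrN -exprVn; apply: phi_integralN; apply: phi_integralX.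
  exact: phi_integral_qqV.
- by rewrite mulr0 expr0z.
- exact: (even_prefactor_at_d _ qq n d a qq_neq0 an _ _ _ nh od (erefl _) tE).
- exact: (even_prefactor _ qq n d a qq_neq0 an _ _ N _ nh (erefl _) tE).
Qed.
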